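(* Let $\theta>0$ be such that there is at least one $\mathbf a$ with $(\theta,\mathbf a)\in\mathcal D$. Then the optimal portfolio in the alternative worst-case approach with constant mean, $$\mathbf a^\star(\theta)=\arg\inf_{\mathbf a:\,(\theta,\mathbf a)\in\mathcal D}\ \frac1\theta\ln\mathbb E\left[\exp(\theta V^{GX}_{\mathbf a}(\mathbf X))\right],$$ is $$\mathbf a^\star(\theta)=\frac{1}{\Gamma^{GX}(\theta,\gamma)}\,\Sigma^{-1}\boldsymbol\mu+\left(1-\frac{A}{\Gamma^{GX}(\theta,\gamma)}\right)\frac{\Sigma^{-1}\mathbf 1}{C},$$ where $$\Gamma^{GX}(\theta,\gamma)=\frac{\gamma C+\sqrt{\gamma^2C^2+4\theta\gamma(C-\theta\gamma)D}}{2(C-\theta\gamma)},$$ and $\Gamma^{GX}(\theta,\gamma)>0$.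
   Context: Let $n\ge1$, $\boldsymbol\mu\in\mathbb R^n$, $\Sigma\in\mathbb R^{n\times n}$ symmetric positive definite, $\gamma>0$, and let $\mathbf X\sim N(\boldsymbol\mu,\Sigma)$ under the nominal model, with expectation $\mathbb E$. Let $\mathbf 1\in\mathbb R^n$ be the all-ones vector and $\mathcal A=\{\mathbf a\in\mathbb R^n:\mathbf a^T\mathbf 1=1\}$ the set of portfolios. Measure of risk in the mean-variance problem with constant mean: $V^{GX}_{\mathbf a}(\mathbf X)=\frac\gamma2\,\mathbf a^T(\mathbf X-\boldsymbol\mu)(\mathbf X-\boldsymbol\mu)^T\mathbf a-\mathbf a^T\boldsymbol\mu$. Domain: $\mathcal D=\{(\theta,\mathbf a):\theta>0,\ \mathbf a\in\mathcal A,\ \theta\,\mathbf a^T\Sigma\,\mathbf a<1/\gamma\}$. Constants: $A=\mathbf 1^T\Sigma^{-1}\boldsymbol\mu$, $B=\boldsymbol\mu^T\Sigma^{-1}\boldsymbol\mu$, $C=\mathbf 1^T\Sigma^{-1}\mathbf 1$, $D=BC-A^2$. *)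

(* Defs.v *)
From HB Require Import structures.
From mathcomp Require Import all_boot all_order all_algebra.
From mathcomp Require Import all_classical all_reals all_analysis.

Set Implicit Arguments.
Unset Strict Implicit.
Unset Printing Implicit Defensive.

Import Order.TTheory GRing.Theory Num.Theory.
Import numFieldNormedType.Exports.

Local Open Scope classical_set_scope.
Local Open Scope ring_scope.

Definition posdefmx (R : realType) (n : nat) (S : 'M[R]_n) : Prop :=
  S^T = S /\ forall u : 'cV[R]_n, u != 0 -> 0 < (u^T *m S *m u) 0 0.

(* The normal law on the line with mean m and *variance* v. The library's
   normal_prob takes the standard deviation, and is not the Dirac mass when
   that is 0, so the degenerate case is treated separately. *)
Definition normal_law (R : realType) (m v : R) (V : set R) : \bar R :=
  if v == 0 then (\d_m V)%E else normal_prob m (Num.sqrt v) V.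

Definition rvec (R : realType) (n : nat) (d : measure_display)
    (T : measurableType d) (P : probability T R) (X : 'I_n -> {RV P >-> R})
    (w : T) : 'cV[R]_n :=
  \col_i X i w.

(* X ~ N(mu, S): every linear combination c^T X of the components is (possibly
   degenerate) normal with mean c^T mu and variance c^T S c. *)
Definition multivariate_normal (R : realType) (n : nat) (d : measure_display)
    (T : measurableType d) (P : probability T R) (X : 'I_n -> {RV P >-> R})
    (mu : 'cV[R]_n) (S : 'M[R]_n) : Prop :=
  forall (c : 'cV[R]_n) (V : set R), measurable V ->
    P [set w | V ((c^T *m rvec X w) 0 0)] =
    normal_law ((c^T *m mu) 0 0) ((c^T *m S *m c) 0 0) V.

Definition ones (R : realType) (n : nat) : 'cV[R]_n := const_mx 1.

Definition portfolios (R : realType) (n : nat) : set 'cV[R]_n :=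
  [set a | (a^T *m ones R n) 0 0 = 1].

Definition VGX (R : realType) (n : nat) (gamma : R) (mu a x : 'cV[R]_n) : R :=
  gamma / 2 * (a^T *m (x - mu) *m (x - mu)^T *m a) 0 0 - (a^T *m mu) 0 0.

Definition domain (R : realType) (n : nat) (gamma : R) (S : 'M[R]_n) :
    set (R * 'cV[R]_n) :=
  [set p | [/\ 0 < p.1, portfolios p.2
             & p.1 * (p.2^T *m S *m p.2) 0 0 < 1 / gamma]].

(* The objective is kept extended-real valued, so that no finiteness of the
   exponential moment is presupposed. *)
Definition entropic_risk (R : realType) (n : nat) (d : measure_display)
    (T : measurableType d) (P : probability T R) (X : 'I_n -> {RV P >-> R})
    (mu : 'cV[R]_n) (gamma theta : R) (a : 'cV[R]_n) : \bar R :=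
  ((1 / theta)%:E *
   lne 'E_P[fun w => expR (theta * VGX gamma mu a (rvec X w))])%E.

(* The set of all points of A at which the infimum of f over A is attained. *)
Definition arginf (R : realType) (U : Type) (A : set U) (f : U -> \bar R) :
    set U :=
  [set a | A a /\ f a = ereal_inf (f @` A)].

Definition cstA (R : realType) (n : nat) (mu : 'cV[R]_n) (S : 'M[R]_n) : R :=
  ((ones R n)^T *m invmx S *m mu) 0 0.

Definition cstB (R : realType) (n : nat) (mu : 'cV[R]_n) (S : 'M[R]_n) : R :=
  (mu^T *m invmx S *m mu) 0 0.

Definition cstC (R : realType) (n : nat) (S : 'M[R]_n) : R :=
  ((ones R n)^T *m invmx S *m ones R n) 0 0.

Definition cstD (R : realType) (n : nat) (mu : 'cV[R]_n) (S : 'M[R]_n) : R :=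
  cstB mu S * cstC S - cstA mu S ^+ 2.

Definition GammaGX (R : realType) (n : nat) (mu : 'cV[R]_n) (S : 'M[R]_n)
    (theta gamma : R) : R :=
  let C := cstC S in
  let D := cstD mu S in
  (gamma * C +
   Num.sqrt (gamma ^+ 2 * C ^+ 2 + 4 * theta * gamma * (C - theta * gamma) * D))
  / (2 * (C - theta * gamma)).

(* Main.v *)
Require Import Defs.
From HB Require Import structures.
From mathcomp Require Import all_boot all_order all_algebra.
From mathcomp Require Import all_classical all_reals all_analysis.
From mathcomp Require Import measurable_realfun.
From mathcomp Require Import ring lra.

Set Implicit Arguments.
Unset Strict Implicit.
Unset Printing Implicit Defensive.

Import Order.TTheory GRing.Theory Num.Theory.
Import numFieldNormedType.Exports.

Local Open Scope classical_set_scope.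
Local Open Scope ring_scope.

(** The exponential moment of the square of a centred Gaussian of variance
    [s] at parameter [k < 1 / (2 s)] is [(1 - 2 k s)^(-1/2)]: completing the
    square turns the tilted density into another Gaussian density.  Hence on the
    domain the objective is
      [f a = - ln (1 - theta gamma s) / (2 theta) - a^T mu],  [s = a^T Sigma a].
    It is convex in [s], and its tangent at the candidate [z] has slope
    [Gamma / 2], because the quadratic equation defining [Gamma] says exactly
    that [1 - theta gamma z^T Sigma z = gamma / Gamma].  The first-order
    condition [Gamma Sigma z = mu + lambda 1] cancels the terms linear in
    [a - z], which leaves
      [f a >= f z + Gamma / 2 (a - z)^T Sigma (a - z)]. *)

(** * Exponential moments of squared Gaussians *)

(** The Radon-Nikodym derivative of [normal_prob] and [normal_pdf] have the same integral over every
    measurable set, so they agree almost everywhere and may be exchanged under the integral. *)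
Lemma ge0_integral_normal_prob (R : realType) (m s : R) (f : R -> \bar R) :
  measurable_fun [set: R] f -> (forall x, 0 <= f x)%E ->
  (\int[normal_prob m s]_x f x =
   \int[lebesgue_measure]_x (f x * (normal_pdf m s x)%:E))%E.
Proof.
move=> mf f0.
have dom := normal_prob_dominates m s.
rewrite -(Radon_Nikodym_SigmaFinite.change_of_variables dom f0)//.
have mpdf : measurable_fun [set: R] (EFin \o normal_pdf m s).
  by apply/measurable_EFinP; exact: measurable_normal_pdf.
have mg := measurable_int _ (Radon_Nikodym_SigmaFinite.f_integrable dom).
apply: ae_eq_integral => //=.
- exact: emeasurable_funM.
- exact: emeasurable_funM.
apply: ae_eqe_mul2l; apply: integral_ae_eq => //.
- exact: Radon_Nikodym_SigmaFinite.f_integrable.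
- by move=> E _ mE; rewrite -(Radon_Nikodym_SigmaFinite.f_integral dom).
Qed.

(** The square is centred where the density is, so the exponents add up without moving the mean;
    only the deviation is rescaled, and the prefactor is the ratio of the two peaks. *)
Lemma normal_pdf_tilt (R : realType) (m s k x : R) :
  s != 0 -> 0 < 1 - 2 * k * s ^+ 2 ->
  expR (k * (x - m) ^+ 2) * normal_pdf m s x =
  (Num.sqrt (1 - 2 * k * s ^+ 2))^-1 *
  normal_pdf m (s / Num.sqrt (1 - 2 * k * s ^+ 2)) x.
Proof.
move=> s0 u0; set u := 1 - _ in u0 *; set q := Num.sqrt u.
have q0 : 0 < q by rewrite sqrtr_gt0.
have q2 : q ^+ 2 = u by rewrite sqr_sqrtr// ltW.
have sq0 : s / q != 0 by rewrite mulf_neq0// invr_eq0 gt_eqF.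
rewrite /normal_pdf (negbTE s0) (negbTE sq0) /normal_fun.
have -> : normal_peak (s / q) = q * normal_peak s.
  rewrite /normal_peak expr_div_n.
  have -> : s ^+ 2 / q ^+ 2 * pi *+ 2 = (s ^+ 2 * pi *+ 2) / q ^+ 2.
    by rewrite -!mulrnAr mulrAC.
  rewrite sqrtrM; last by rewrite mulrn_wge0// mulr_ge0 ?pi_ge0// sqr_ge0.
  by rewrite sqrtrV ?sqr_ge0// sqrtr_sqr gtr0_norm// invf_div.
rewrite !mulrA mulVf ?gt_eqF// mul1r mulrAC mulrC; congr (_ * _).
rewrite -expRD; congr expR.
rewrite expr_div_n q2 /u; field.
by rewrite s0 /= gt_eqF.
Qed.

Lemma integral_normal_prob_expR_sqr (R : realType) (m s k : R) :
  s != 0 -> 0 < 1 - 2 * k * s ^+ 2 ->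
  (\int[normal_prob m s]_x (expR (k * (x - m) ^+ 2))%:E =
   (Num.sqrt (1 - 2 * k * s ^+ 2))^-1%:E)%E.
Proof.
move=> s0 u0.
rewrite ge0_integral_normal_prob//=; last first.
  apply/measurable_EFinP; apply: measurableT_comp => //.
  apply: measurable_funM => //; apply: measurable_funX.
  exact: measurable_funB.
under eq_integral do rewrite -EFinM normal_pdf_tilt// EFinM.
rewrite ge0_integralZl//=.
- by rewrite integral_normal_pdf mule1.
- by apply/measurable_EFinP; exact: measurable_normal_pdf.
- by move=> x _; rewrite lee_fin normal_pdf_ge0.
Qed.

(** * The objective in closed form *)

(** The randomness enters only through the scalar [a^T x], so one-dimensional laws suffice for the
    expectation. *)
Lemma VGXE (R : realType) (n : nat) (gamma : R) (mu a x : 'cV[R]_n) :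
  VGX gamma mu a x = gamma / 2 * ((a^T *m x) 0 0 - (a^T *m mu) 0 0) ^+ 2
                     - (a^T *m mu) 0 0.
Proof.
rewrite /VGX; congr (_ * _ - _); rewrite -mulmxA mxE big_ord1 expr2.
have -> : (x - mu)^T *m a = (a^T *m (x - mu))^T by rewrite trmx_mul trmxK.
by rewrite [X in _ * X = _]mxE mulmxBr mxE [X in _ + X]mxE.
Qed.

Lemma measurable_dot_rvec (R : realType) (n : nat) (d : measure_display)
    (T : measurableType d) (P : probability T R) (X : 'I_n -> {RV P >-> R})
    (c : 'cV[R]_n) :
  measurable_fun setT (fun w => (c^T *m rvec X w) 0 0).
Proof.
under eq_fun do rewrite mxE.
apply: measurable_sum => i; under eq_fun do rewrite !mxE.
by apply: measurable_funM => //; exact: measurable_funP.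
Qed.

Lemma entropic_riskE (R : realType) (n : nat) (d : measure_display)
    (T : measurableType d) (P : probability T R) (X : 'I_n -> {RV P >-> R})
    (mu : 'cV[R]_n) (S : 'M[R]_n) (gamma theta : R) (a : 'cV[R]_n) :
  multivariate_normal X mu S -> 0 < theta ->
  0 < (a^T *m S *m a) 0 0 -> 0 < 1 - theta * gamma * (a^T *m S *m a) 0 0 ->
  entropic_risk X mu gamma theta a =
  (- ln (1 - theta * gamma * (a^T *m S *m a) 0 0) / (2 * theta)
   - (a^T *m mu) 0 0)%:E.
Proof.
move=> XN theta0; set s := (a^T *m S *m a) 0 0; set m := (a^T *m mu) 0 0.
move=> s0 u0; set u := 1 - _ in u0 *.
have q0 : 0 < Num.sqrt u by rewrite sqrtr_gt0.
pose Y w := (a^T *m rvec X w) 0 0.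
pose mY := isMeasurableFun.Build _ _ T (measurableTypeR R) Y
  (measurable_dot_rvec X a).
pose YRV : {RV P >-> measurableTypeR R} := HB.pack Y mY.
pose h (y : R) := (expR (theta * gamma / 2 * (y - m) ^+ 2))%:E.
have mh : measurable_fun setT h.
  apply/measurable_EFinP; apply: measurableT_comp => //.
  apply: measurable_funM => //; apply: measurable_funX.
  exact: measurable_funB.
have h0 y : (0 <= h y)%E by rewrite lee_fin expR_ge0.
have hY : (\int[P]_w h (Y w) = (Num.sqrt u)^-1%:E)%E.
  transitivity (\int[normal_prob m (Num.sqrt s)]_y h y)%E.
    (* Pass to the pushforward of [P] under [Y]; as [s > 0], the hypothesis [XN] identifies it with
       a genuine normal law, not a Dirac mass. *)
    rewrite -(ge0_integral_distribution YRV mh)//.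
    apply: eq_measure_integral => A mA _.
    by have := XN a A mA; rewrite /normal_law gt_eqF.
  have sqs : Num.sqrt s ^+ 2 = s by rewrite sqr_sqrtr// ltW.
  have uE : u = 1 - 2 * (theta * gamma / 2) * Num.sqrt s ^+ 2.
    by rewrite sqs /u; field.
  by rewrite integral_normal_prob_expR_sqr -?uE// gt_eqF// sqrtr_gt0.
rewrite /entropic_risk unlock.
have -> : (\int[P]_w (expR (theta * VGX gamma mu a (rvec X w)))%:E =
           (expR (- (theta * m)) / Num.sqrt u)%:E)%E.
  rewrite EFinM -hY -ge0_integralZl//=.
  - apply: eq_integral => w _; rewrite -EFinM -expRD; congr (expR _)%:E.
    by rewrite VGXE -/(Y w) -/m; field.
  - by apply: (measurableT_comp mh); exact: measurable_dot_rvec.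
rewrite lne_EFin ?divr_gt0 ?expR_gt0// -EFinM; congr EFin.
rewrite ln_div ?posrE ?expR_gt0// expRK.
have -> : ln u = 2 * ln (Num.sqrt u).
  by rewrite -[in LHS](sqr_sqrtr (ltW u0)) lnXn//; ring.
by field; rewrite gt_eqF.
Qed.

(** * The bilinear form of a positive definite matrix *)

Lemma dotC (R : realType) (n : nat) (u v : 'cV[R]_n) :
  (u^T *m v) 0 0 = (v^T *m u) 0 0.
Proof.
have -> : u^T *m v = (v^T *m u)^T by rewrite trmx_mul trmxK.
by rewrite mxE.
Qed.

Definition mxform (R : realType) (n : nat) (S : 'M[R]_n) (u v : 'cV[R]_n) : R :=
  (u^T *m S *m v) 0 0.

Section Mxform.
Variables (R : realType) (n : nat) (S : 'M[R]_n).
Implicit Types (u v : 'cV[R]_n) (k : R).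

Lemma mxformDr u v w : mxform S u (v + w) = mxform S u v + mxform S u w.
Proof. by rewrite /mxform mulmxDr mxE. Qed.

Lemma mxformDl u v w : mxform S (u + v) w = mxform S u w + mxform S v w.
Proof. by rewrite /mxform linearD/= !mulmxDl mxE. Qed.

Lemma mxformZr k u v : mxform S u (k *: v) = k * mxform S u v.
Proof. by rewrite /mxform -scalemxAr mxE. Qed.

Lemma mxformZl k u v : mxform S (k *: u) v = k * mxform S u v.
Proof. by rewrite /mxform linearZ/= -!scalemxAl mxE. Qed.

(** [invmx S *m v] is the Riesz representative of [v] for this form; mean and budget thus become
    products with [invmx S *m mu] and [invmx S *m ones]. *)
Lemma mxform_invmx u v : S \in unitmx ->
  mxform S u (invmx S *m v) = (u^T *m v) 0 0.
Proof. by move=> uS; rewrite /mxform -!mulmxA mulKVmx. Qed.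

Hypothesis pS : posdefmx S.

Lemma mxformC u v : mxform S u v = mxform S v u.
Proof.
have [symS _] := pS.
have -> : mxform S u v = (u^T *m S *m v)^T 0 0 by rewrite mxE.
by rewrite !trmx_mul trmxK symS mulmxA.
Qed.

Lemma mxform_gt0 u : u != 0 -> 0 < mxform S u u.
Proof. by have [_] := pS; apply. Qed.

Lemma mxform_ge0 u : 0 <= mxform S u u.
Proof.
have [->|/mxform_gt0/ltW//] := eqVneq u 0.
by rewrite /mxform mulmx0 mxE.
Qed.

Lemma posdefmx_unit : S \in unitmx.
Proof.
rewrite unitmxE unitfE; apply/negP => /det0P[v v0 vS].
have /mxform_gt0 : v^T != 0 by rewrite trmx_eq0.
by rewrite /mxform trmxK vS mul0mx mxE ltxx.
Qed.

(** For [v != 0], the form at [F(v,v) u - F(u,v) v] is nonnegative and factors as [F(v,v)] times the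
    difference of the two sides. *)
Lemma mxform_cauchy_schwarz u v :
  mxform S u v ^+ 2 <= mxform S u u * mxform S v v.
Proof.
have [->|v0] := eqVneq v 0.
  by rewrite /mxform !mulmx0 mxE expr0n/= mulr0.
have vv := mxform_gt0 v0.
have := mxform_ge0 (mxform S v v *: u + - mxform S u v *: v).
rewrite !(mxformDl, mxformDr, mxformZl, mxformZr) (mxformC v u).
set a := mxform S u u; set b := mxform S u v; set c := mxform S v v.
have -> : c * (c * a + - b * b) + (c * (- b * b) + - b * (- b * c)) =
  c * (a * c - b ^+ 2).
  by ring.
by rewrite pmulr_rge0// subr_ge0.
Qed.

End Mxform.

(** [GammaGX] is the larger root of this quadratic: the leading coefficient is positive and the
    discriminant nonnegative. *)
Lemma GammaGX_root (R : realType) (n : nat) (mu : 'cV[R]_n) (S : 'M[R]_n)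
    (t g : R) :
  0 < cstC S -> 0 <= cstD mu S -> 0 < g -> 0 < t -> 0 < cstC S - t * g ->
  0 < GammaGX mu S t g /\
  (cstC S - t * g) * GammaGX mu S t g ^+ 2 =
  g * cstC S * GammaGX mu S t g + t * g * cstD mu S.
Proof.
rewrite /GammaGX; set C := cstC S; set D := cstD mu S => C0 D0 g0 t0 e0.
set disc := g ^+ 2 * C ^+ 2 + _.
have disc0 : 0 <= disc by rewrite addr_ge0 ?mulr_ge0 ?sqr_ge0// ltW.
have sq := sqr_sqrtr disc0; have r0 := sqrtr_ge0 disc.
split.
  by apply: divr_gt0; [rewrite ltr_wpDr// mulr_gt0 | rewrite mulr_gt0].
move: r0 sq; set r := Num.sqrt _ => r0.
rewrite /disc; set e := C - _ in e0 * => sq.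
have -> : e * ((g * C + r) / (2 * e)) ^+ 2 =
  (g ^+ 2 * C ^+ 2 + 2 * g * C * r + r ^+ 2) / (4 * e).
  by field; rewrite gt_eqF.
by rewrite sq; field; rewrite gt_eqF.
Qed.

(** Concavity of the logarithm, from [ln (1 + h) <= h] at [h = x / y - 1]. *)
Lemma ln_tangent (R : realType) (x y : R) :
  0 < x -> 0 < y -> ln x <= ln y + (x - y) / y.
Proof.
move=> x0 y0; rewrite -lerBlDl -ln_div ?posrE//.
have -> : x / y = 1 + (x - y) / y by field; rewrite gt_eqF.
apply: le_ln1Dx.
have -> : (x - y) / y = x / y - 1 by field; rewrite gt_eqF.
by rewrite ltrDr divr_gt0.
Qed.

(** * Optimality and uniqueness of the candidate *)

Theorem theorem9 (R : realType) (n : nat) (mu : 'cV[R]_n) (Sigma : 'M[R]_n)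
    (gamma : R) (d : measure_display) (T : measurableType d)
    (P : probability T R) (X : 'I_n -> {RV P >-> R}) (theta : R) :
  (0 < n)%N ->
  posdefmx Sigma ->
  0 < gamma ->
  multivariate_normal X mu Sigma ->
  0 < theta ->
  (exists a : 'cV[R]_n, domain gamma Sigma (theta, a)) ->
  arginf [set a : 'cV[R]_n | domain gamma Sigma (theta, a)]
         (entropic_risk X mu gamma theta)
  = [set (1 / GammaGX mu Sigma theta gamma) *: (invmx Sigma *m mu)
         + ((1 - cstA mu Sigma / GammaGX mu Sigma theta gamma) / cstC Sigma)
             *: (invmx Sigma *m ones R n)]
  /\ 0 < GammaGX mu Sigma theta gamma.
Proof.
move=> n0 pS g0 XN t0 [b []]; rewrite /= => _ b1 bS.
have uS := posdefmx_unit pS.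
set F := mxform Sigma.
pose v := invmx Sigma *m mu; pose w := invmx Sigma *m ones R n.
have Fv a : F a v = (a^T *m mu) 0 0 by exact: mxform_invmx.
have Fw a : F a w = (a^T *m ones R n) 0 0 by exact: mxform_invmx.
have FC a c : F a c = F c a by exact: mxformC.
have w0 : w != 0.
  apply/eqP => w0; have := mulKVmx uS (ones R n); rewrite -/w w0 mulmx0.
  by move=> /matrixP/(_ (Ordinal n0) 0)/eqP; rewrite !mxE eq_sym oner_eq0.
set C := cstC Sigma; set A := cstA mu Sigma; set G := GammaGX _ _ _ _.
have CE : C = F w w by rewrite Fw dotC mulmxA.
have AE : A = F v w by rewrite Fw dotC mulmxA.
have BE : cstB mu Sigma = F v v by rewrite Fv dotC mulmxA.
have C0 : 0 < C by rewrite CE; exact: mxform_gt0.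
have D0 : 0 <= cstD mu Sigma.
  by rewrite /cstD -/A -/C BE CE AE subr_ge0; exact: mxform_cauchy_schwarz.
have dom1 a : theta * F a a < 1 / gamma -> 0 < 1 - theta * gamma * F a a.
  by rewrite ltr_pdivlMr// mulrAC subr_gt0.
(* A feasible [b] has [F b w = 1], so Cauchy-Schwarz gives [1 <= F b b * C], while
   [theta * gamma * F b b < 1]. *)
have e0 : 0 < C - theta * gamma.
  have := mxform_cauchy_schwarz pS b w; rewrite -/F Fw b1 -CE expr1n => bC.
  have := dom1 b bS; have tg0 := mulr_gt0 t0 g0.
  by rewrite !subr_gt0; nra.
have [G0 Groot] := GammaGX_root C0 D0 g0 t0 e0.
rewrite -/G -/C in G0 Groot.
split=> //; set z := _ + _.
(* The first-order condition tested against [c], with multiplier [(G - A) / C]; after [clearbody],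
   [z] is known only through this and its budget equation. *)
have zE c : F c z = (F c v + (G - A) / C * F c w) / G.
  rewrite /z -/v -/w /F mxformDr !mxformZr -/F.
  by field; rewrite !gt_eqF.
have z1 : (z^T *m ones R n) 0 0 = 1.
  by rewrite -Fw FC zE (FC w v) -AE -CE; field; rewrite !gt_eqF.
clearbody z.
have zz : theta * gamma * F z z = 1 - gamma / G.
  rewrite zE Fw z1 FC zE -AE -BE.
  have DE : cstD mu Sigma = cstB mu Sigma * C - A ^+ 2 by [].
  rewrite DE in Groot.
  (* Clearing the denominators [C] and [G ^+ 2] turns the claim into the quadratic equation
     [Groot]. *)
  apply: (mulIf (x := C * G ^+ 2)).
    by rewrite mulf_neq0 ?expf_neq0 ?gt_eqF.
  transitivity (theta * gamma * (cstB mu Sigma * C - A ^+ 2 + G ^+ 2)).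
    by field; rewrite !gt_eqF.
  have -> : (1 - gamma / G) * (C * G ^+ 2) = C * G ^+ 2 - gamma * C * G.
    by field; rewrite gt_eqF.
  have -> : C * G ^+ 2 = (C - theta * gamma) * G ^+ 2 + theta * gamma * G ^+ 2.
    by ring.
  by rewrite Groot; ring.
have zdom : domain gamma Sigma (theta, z).
  split=> //=.
  rewrite -/(mxform _ _ _) -/F ltr_pdivlMr// mulrAC zz ltrBlDr ltrDl.
  exact: divr_gt0.
have risk a : domain gamma Sigma (theta, a) ->
    entropic_risk X mu gamma theta a =
    (- ln (1 - theta * gamma * F a a) / (2 * theta) - F a v)%:E.
  move=> [_ /= a1 aS]; rewrite Fv; apply: entropic_riskE => //.
  (* The zero vector violates the budget constraint. *)
  - apply: mxform_gt0 => //; apply/eqP => a0; move: a1.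
    rewrite /portfolios/= a0 trmx0 mul0mx mxE => /eqP.
    by rewrite eq_sym oner_eq0.
  - exact: dom1.
have gap a : domain gamma Sigma (theta, a) ->
    - ln (1 - theta * gamma * F z z) / (2 * theta) - F z v
      + G / 2 * F (a - z) (a - z) <=
    - ln (1 - theta * gamma * F a a) / (2 * theta) - F a v.
  move=> [_ /= a1 /dom1 aS].
  have gG : 0 < gamma / G by rewrite divr_gt0.
  (* Both portfolios have budget 1, so [a - z] is orthogonal to [w] and the multiplier term drops
     out. *)
  have Fhz : F (a - z) z = (F a v - F z v) / G.
    rewrite zE -(scaleN1r z) /F !mxformDl !mxformZl -/F !Fw a1 z1.
    by field; rewrite !gt_eqF.
  have Faa : F a a = F z z + 2 * F (a - z) z + F (a - z) (a - z).
    have := subrK z a; move: (a - z) => h <-.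
    by rewrite /F mxformDr !mxformDl -/F (FC z h); ring.
  have zz1 : 1 - theta * gamma * F z z = gamma / G by rewrite zz subKr.
  have := ln_tangent aS gG; rewrite -{1}zz1.
  have -> : (1 - theta * gamma * F a a - gamma / G) / (gamma / G) =
      - (2 * theta) * (F a v - F z v + G / 2 * F (a - z) (a - z)).
    have -> : 1 - theta * gamma * F a a - gamma / G =
        - (theta * gamma) * (F a a - F z z) by rewrite -zz1; ring.
    by rewrite Faa Fhz; field; rewrite !gt_eqF.
  move: (ln (1 - _ * F a a)) (ln (1 - _ * F z z)) => L1 L2.
  have -> : L2 + - (2 * theta) * (F a v - F z v + G / 2 * F (a - z) (a - z)) =
    (L2 / (2 * theta) - (F a v - F z v + G / 2 * F (a - z) (a - z)))
    * (2 * theta) by field; rewrite gt_eqF.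
  by rewrite -ler_pdivrMr ?mulr_gt0// => le12; rewrite !mulNr; lra.
apply/seteqP; split=> [a [ad ainf]|_ ->].
  have : (entropic_risk X mu gamma theta a <=
          entropic_risk X mu gamma theta z)%E.
    by rewrite ainf; apply: ereal_inf_lbound; exists z.
  rewrite !risk// lee_fin => az; have := gap a ad.
  (* If [a != z], the quadratic term in [gap] is positive, contradicting the minimality of [a]. *)
  have [/subr0_eq->//|/(mxform_gt0 pS) q0] := eqVneq (a - z) 0.
  have : 0 < G / 2 * F (a - z) (a - z) by rewrite mulr_gt0// divr_gt0.
  by move=> gq le2; move: (lt_le_trans (ltr_pwDr gq az) le2); rewrite ltxx.
split=> //; apply/eqP; rewrite eq_le; apply/andP; split.
  apply: le_ereal_inf_tmp => _ [a ad <-]; rewrite !risk// lee_fin.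
  apply: le_trans (gap a ad); rewrite lerDl.
  by apply: mulr_ge0; [rewrite divr_ge0 ?ltW|exact: mxform_ge0].
by apply: ereal_inf_lbound; exists z.
Qed.
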